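(* Let $(\star)$ be a linear system over $\mathbb{F}_q$ with coefficient matrix $A\in\mathbb{F}_q^{m\times k}$ which is of type (RC), non-degenerate and irreducible, with $\ell$ column equivalence classes. Then there exist constants $\beta,\gamma>0$ with $\gamma<q$ such that for every $n$, every subset $S\subseteq\mathbb{F}_q^n$ with $|S|\ge\beta\gamma^n$ contains a solution $(x_1,\dots,x_k)\in S^k$ of $(\star)$ such that: (i) every balanced linear equation satisfied by $(x_1,\dots,x_k)$ preserves the column equivalence classes of $(\star)$; (ii) $\dim(\mathrm{aff}(x_1,\dots,x_k))\ge\min(k-\ell,\,k-2)$.
   Context: Let $\mathbb{F}_q$ be a finite field. A linear system $(\star)$ with coefficient matrix $A=(a_{ij})\in\mathbb{F}_q^{m\times k}$ is the system $\sum_j a_{ij}x_j=0$ ($i\in[m]$), with solutions $(x_1,\dots,x_k)\in(\mathbb{F}_q^n)^k$. A linear equation $b_1x_1+\dots+b_kx_k=0$ is balanced if $b_1+\dots+b_k=0$; the system is balanced if every row of $A$ sums to $0$. Two indices $j,j'\in[k]$ are equivalent if columns $j,j'$ of $A$ are nonzero scalar multiples of one another; the classes are the column equivalence classes. An equation with coefficient vector $b$ preserves the column equivalence classes of $(\star)$ if the matrix obtained by appending $b$ as an extra row to $A$ has the same column equivalence classes as $A$. Type (RC): balanced with at most one column equivalence class of size $1$. Non-degenerate: rows of $A$ linearly independent and no zero column. Two systems are equivalent if each equation of one is a linear combination of those of the other. Reducible: equivalent to a system whose variables can be partitioned into at least two classes with each equation only using (nonzero coefficients on) variables of one class; otherwise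 irreducible. $\mathrm{aff}(\cdot)$ denotes affine hull and $\dim$ its affine dimension. *)

(* Defs.v *)
From HB Require Import structures.
From mathcomp Require Import all_boot all_order all_algebra all_field.
From mathcomp Require Export reals.
Set Implicit Arguments. Unset Strict Implicit. Unset Printing Implicit Defensive.
Import Order.TTheory GRing.Theory Num.Theory.
Local Open Scope ring_scope.

Section Defs.
Variable F : finFieldType.

Definition colequiv (m k : nat) (M : 'M[F]_(m, k)) (j j' : 'I_k) : bool :=
  [exists c : F, (c != 0) && (col j M == c *: col j' M)].

Definition colclass (m k : nat) (M : 'M[F]_(m, k)) (j : 'I_k) : {set 'I_k} :=
  [set j' | colequiv M j j'].

Definition nclasses (m k : nat) (M : 'M[F]_(m, k)) : nat :=
  #|[set colclass M j | j : 'I_k]|.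

Definition balanced_sys (m k : nat) (A : 'M[F]_(m, k)) : Prop :=
  forall i : 'I_m, \sum_(j < k) A i j = 0.

Definition sys_typeRC (m k : nat) (A : 'M[F]_(m, k)) : Prop :=
  balanced_sys A /\ (#|[set C in [set colclass A j | j : 'I_k] | #|C| == 1%N]| <= 1)%N.

Definition sys_nondegenerate (m k : nat) (A : 'M[F]_(m, k)) : Prop :=
  row_free A /\ forall j : 'I_k, col j A != 0.

(* systems with the same row space are equivalent *)
Definition sys_reducible (m k : nat) (A : 'M[F]_(m, k)) : Prop :=
  exists (m' : nat) (B : 'M[F]_(m', k)) (p : 'I_k -> nat),
    (B == A)%MS /\
    (exists j1 j2 : 'I_k, p j1 != p j2) /\
    (forall (i : 'I_m') (j j' : 'I_k), B i j != 0 -> B i j' != 0 -> p j = p j').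

Definition sys_irreducible (m k : nat) (A : 'M[F]_(m, k)) : Prop := ~ sys_reducible A.

Definition is_solution (m k n : nat) (A : 'M[F]_(m, k)) (x : 'I_k -> 'rV[F]_n) : Prop :=
  forall i : 'I_m, \sum_(j < k) A i j *: x j = 0.

Definition affdim (k n : nat) (x : 'I_k -> 'rV[F]_n) : int :=
  if k == 0%N then (-1)%R
  else (\dim (span [seq x i - x j | i <- enum 'I_k, j <- enum 'I_k]))%:Z.

Definition preserves_classes (m k : nat) (A : 'M[F]_(m, k)) (b : 'rV[F]_k) : Prop :=
  forall j j' : 'I_k, colequiv (col_mx A b) j j' = colequiv A j j'.

End Defs.

(* Main.v *)
(** Write [c_j] for the factor of column [j] over the representative of its
    class, so that the system only sees the class sums [y_i = sum c_j x_j], and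
    start from a solution whose class sums do not all degenerate: a constant one
    if some class has [sum c_j <> 0]; otherwise irreducibility gives a dependency
    [lambda] of the representative columns, and the pigeonhole principle gives
    points of [S] with [z_i - z'_i = lambda_i y] for a common [y <> 0].

    The start is then made generic without touching the class sums, by replacing
    pairs [(x_j, x_rep j)] with other pairs of the same weighted sum.  This needs a
    large subset [S1] of [S] all of whose pairs (also the pairs [(x, x)]) have many
    such replacements in [S].  The pairs of points whose sum has few replacements
    form a sparse graph, and on an independent set of that graph, by the slice rank
    bound for [a x + b y = (a + b) z], only few [(x, x)] can fail.  One such
    passage to a subset is made for each exchanged pair. *)

Require Import Defs.
From HB Require Import structures.
From mathcomp Require Import all_boot all_order all_algebra all_field.
From mathcomp Require Import reals.
From mathcomp Require Import zify ring lra.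
Import Order.TTheory GRing.Theory Num.Theory.
Local Open Scope ring_scope.

(** * The slice rank bound *)

(** The left kernel of [P] has dimension [d >= N - r], and a basis of it has an invertible minor of
    size [d], so a kernel vector can be prescribed freely on the [d] columns of that minor. *)
Lemma left_kernel_ones (F : fieldType) (N r : nat) (P : 'M[F]_(N, r)) :
  exists (d : nat) (h : 'rV[F]_N) (f : 'I_d -> 'I_N),
    [/\ injective f, h *m P = 0, (forall i, h 0 (f i) = 1) & (N <= d + r)%N].
Proof.
pose W := row_base (kermx P).
have full : row_full W^T by rewrite /row_full mxrank_tr; exact: row_base_free.
pose f := fullrankfun full.
pose B := rowsub f W^T.
have uB : B \in unitmx by exact: fullrowsub_unit.
exists (\rank (kermx P)), ((const_mx 1 : 'rV_(\rank (kermx P))) *m invmx B^T *m W), f; split.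
- exact: fullrankfun_inj.
- apply/sub_kermxP; apply: submx_trans (submxMl _ _) _.
  by rewrite eq_row_base.
- move=> i.
  set u := _ *m invmx B^T.
  have uB1 : (u *m B^T) 0 i = 1 by rewrite mulmxKV ?unitmx_tr // mxE.
  rewrite -[RHS]uB1 !mxE; apply: eq_bigr => j _.
  by rewrite [B^T _ _]mxE [B _ _]mxE [W^T _ _]mxE.
- by rewrite mxrank_ker; have := rank_leq_col P; lia.
Qed.

Lemma mxrank_diag_ge (F : fieldType) (N d : nat) (h : 'rV[F]_N) (f : 'I_d -> 'I_N) :
  injective f -> (forall i, h 0 (f i) = 1) -> (d <= \rank (diag_mx h))%N.
Proof.
move=> f_inj hf.
have <- : \rank (rowsub f 1%:M *m diag_mx h *m colsub f 1%:M) = d.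
  suff -> : rowsub f 1%:M *m diag_mx h *m colsub f 1%:M = 1%:M by rewrite mxrank1.
  apply/matrixP => i j; rewrite -mulmxA mul_diag_mx !mxE (bigD1 (f i)) //=.
  rewrite !mxE eqxx mul1r hf mul1r big1 => [|l nl].
    by rewrite addr0 (inj_eq f_inj).
  by rewrite !mxE eq_sym (negPf nl) mul0r.
apply: leq_trans (mxrankM_maxl _ _) _; exact: mxrankM_maxr.
Qed.

(** Slice rank argument: contracting the third index with a vector [h] orthogonal to the slices
    [p3 e], [e \in M], leaves a diagonal matrix of rank at least [N - #|M|]. The surviving terms
    have [e1] or [e2] in [M], so they give rank at most [2 * #|M|]. *)
Lemma slice_rank_diag (F : fieldType) (N : nat) (E W : finType) (M : {set E})
    (e1 e2 e3 : W -> E) (p1 p2 p3 : E -> 'I_N -> F) (kappa : W -> F) :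
  (forall w, [|| e1 w \in M, e2 w \in M | e3 w \in M]) ->
  (forall i j l, \sum_w kappa w * (p1 (e1 w) i * p2 (e2 w) j * p3 (e3 w) l)
     = ((i == j) && (j == l))%:R) ->
  (N <= 3 * #|M|)%N.
Proof.
move=> cover diag.
pose P (p : E -> 'I_N -> F) := \matrix_(i < N, s < #|M|) p (enum_val s) i.
have [d [h [f [f_inj hP hf leN]]]] := left_kernel_ones _ _ _ (P p3).
suff : (d <= #|M| + #|M|)%N by move: leN; lia.
have hp e : e \in M -> \sum_l h 0 l * p3 e l = 0.
  move=> eM; have := congr1 (fun u : 'rV_#|M| => u 0 (enum_rank_in eM e)) hP.
  rewrite !mxE => hpe; rewrite -[RHS]hpe; apply: eq_bigr => l _.
  by rewrite !mxE enum_rankK_in.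
pose c w := \sum_l h 0 l * p3 (e3 w) l.
pose X := \matrix_(s < #|M|, j < N)
  \sum_(w | e1 w == enum_val s) kappa w * c w * p2 (e2 w) j.
pose Y := \matrix_(i < N, s < #|M|)
  \sum_(w | (e1 w \notin M) && (e2 w == enum_val s)) kappa w * c w * p1 (e1 w) i.
have sumM (G : E -> F) : \sum_(s < #|M|) G (enum_val s) = \sum_(e in M) G e.
  by rewrite [RHS]big_enum_val.
have dE : diag_mx h = P p1 *m X + Y *m (P p2)^T.
  apply/matrixP => i j; transitivity (\sum_w kappa w * c w * (p1 (e1 w) i * p2 (e2 w) j)).
    transitivity (\sum_l h 0 l * ((i == j) && (j == l))%:R).
      rewrite mxE (bigD1 j) //= eqxx andbT big1 ?addr0 => [|l nl].
        by case: eqP => [->|]; rewrite ?mulr1n ?mulr1 ?mulr0n ?mulr0.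
      by rewrite eq_sym in nl; rewrite (negPf nl) andbF mulr0.
    under eq_bigr => l _ do rewrite -diag mulr_sumr.
    rewrite exchange_big /=; apply: eq_bigr => w _.
    rewrite /c mulr_sumr mulr_suml; apply: eq_bigr => l _; ring.
  rewrite (bigID (fun w => e1 w \in M)) /=.
  rewrite [X in _ + X](bigID (fun w => e2 w \in M)) /=.
  rewrite [X in _ + (_ + X)]big1 ?addr0; last first.
    move=> w /andP[n1 n2]; have := cover w; rewrite (negPf n1) (negPf n2) /= => e3M.
    by rewrite /c hp // mulr0 mul0r.
  rewrite !mxE; congr (_ + _).
    rewrite (partition_big e1 (mem M)) //= -sumM; apply: eq_bigr => s _.
    rewrite !mxE mulr_sumr; apply: eq_big => [w|w /andP[_ /eqP <-]]; last by ring.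
    by case: eqP => [->|_]; rewrite ?andbF ?andbT // enum_valP.
  rewrite (partition_big e2 (mem M)) => [|w /andP[]//] /=; rewrite -sumM.
  apply: eq_bigr => s _; rewrite !mxE mulr_suml.
  apply: eq_big => [w|w /andP[_ /eqP <-]]; last by ring.
  by case: eqP => [->|_]; rewrite ?andbF ?andbT // enum_valP andbT.
apply: leq_trans (mxrank_diag_ge _ _ _ _ _ f_inj hf) _.
rewrite dE; apply: leq_trans (mxrank_add _ _) _; apply: leq_add.
  exact: leq_trans (mxrankM_maxl _ _) (rank_leq_col _).
exact: leq_trans (mxrankM_maxr _ _) (rank_leq_row _).
Qed.

(** The index [inl tt] stands for the constant term of [1 - (u + v + w)^d], and [inr (i, j)] for the
    monomial [u^(d-i) v^(i-j) w^j]. *)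
Definition expo1 d (o : unit + 'I_d.+1 * 'I_d.+1) : 'I_d.+1 :=
  if o is inr (i, j) then rev_ord i else ord0.
Definition expo2 d (o : unit + 'I_d.+1 * 'I_d.+1) : 'I_d.+1 :=
  if o is inr (i, j) then inord (i - j) else ord0.
(* The [minn] keeps the total degree at [d] also for the pairs [i < j], whose
   coefficient is zero. *)
Definition expo3 d (o : unit + 'I_d.+1 * 'I_d.+1) : 'I_d.+1 :=
  if o is inr (i, j) then inord (minn i j) else ord0.
Definition trinom (F : fieldType) d (o : unit + 'I_d.+1 * 'I_d.+1) : F :=
  if o is inr (i, j) then - ('C(d, i) * 'C(i, j))%:R else 1.

Lemma expo_sum d (o : unit + 'I_d.+1 * 'I_d.+1) :
  (expo1 d o + expo2 d o + expo3 d o <= d)%N.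
Proof.
case: o => [[]|[i j]] //=; rewrite !inordK; have := ltn_ord i; lia.
Qed.

Lemma one_sub_trinomial (F : fieldType) d (u v w : F) :
  1 - (u + v + w) ^+ d =
  \sum_o trinom F d o * (u ^+ expo1 d o * v ^+ expo2 d o * w ^+ expo3 d o).
Proof.
rewrite big_sumType /=; congr (_ + _).
  by rewrite (bigD1 tt) //= big_pred0 => [|[]//]; rewrite !expr0 !mulr1 addr0.
rewrite -addrA exprDn -sumrN.
transitivity (\sum_(i < d.+1) \sum_(j < d.+1) - ('C(d, i) * 'C(i, j))%:R *
  (u ^+ (d - i) * v ^+ (i - j) * w ^+ minn i j)).
  apply: eq_bigr => i _; rewrite exprDn mulr_sumr -sumrMnl -sumrN.
  rewrite (big_ord_widen d.+1 (fun j =>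
    - (u ^+ (d - i) * (v ^+ (i - j) * w ^+ j *+ 'C(i, j)) *+ 'C(d, i)))) ?ltn_ord //.
  rewrite big_mkcond; apply: eq_bigr => j _; case: ltnP => [ij|ij]; last first.
    by rewrite (bin_small ij) muln0 oppr0 mul0r.
  have -> : minn i j = j by lia.
  by rewrite -[_ *+ 'C(d, i)]mulr_natl -[_ *+ 'C(i, j)]mulr_natl natrM; ring.
rewrite pair_bigA /=; apply: eq_bigr => -[i j] _ /=.
by rewrite subSS !inordK //; have := ltn_ord i; lia.
Qed.

(** The threshold is one third because among three exponent vectors of total degree at most [d * n],
    one must lie in this set. *)
Definition lowdeg d n : {set {ffun 'I_n -> 'I_d.+1}} :=
  [set e : {ffun 'I_n -> 'I_d.+1} | 3 * \sum_t (e t : nat) <= d * n]%N.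

Lemma fin_eq0_indicator (F : finFieldType) (x : F) :
  1 - x ^+ #|F|.-1 = (x == 0)%:R.
Proof.
have [d qE] : exists d, #|F| = d.+2.
  by exists (#|F| - 2)%N; rewrite -addn2 subnK // finNzRing_gt1.
rewrite qE /=; case: eqVneq => [->|nx]; first by rewrite expr0n subr0.
apply/eqP; rewrite subr_eq0 eq_sym; apply/eqP/(mulfI nx).
by rewrite -exprS -qE mulr1 expf_card.
Qed.

(** With [q = #|F|], the product over [t] of [1 - (a x_t + b y_t - (a + b) z_t)^(q-1)] is the
    indicator of the equation, hence the diagonal tensor on [S]. Its degree is at most [(q - 1) n],
    so in each monomial the part in [x], in [y] or in [z] has low degree. *)
Lemma cap_bound (F : finFieldType) (n : nat) (a b : F) (S : {set 'rV[F]_n}) :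
  (forall x y z, x \in S -> y \in S -> z \in S ->
     a *: x + b *: y = (a + b) *: z -> x = y /\ y = z) ->
  (#|S| <= 3 * #|lowdeg #|F|.-1 n|)%N.
Proof.
move=> capS; set d := #|F|.-1.
pose O := (unit + 'I_d.+1 * 'I_d.+1)%type.
pose lift (f : O -> 'I_d.+1) (w : {ffun 'I_n -> O}) := [ffun t => f (w t)].
pose p (c : F) (e : {ffun 'I_n -> 'I_d.+1}) (i : 'I_#|S|) : F :=
  \prod_t (c * enum_val i 0 t) ^+ e t.
apply: (slice_rank_diag F _ _ _ _ (lift (expo1 d)) (lift (expo2 d))
  (lift (expo3 d)) (p a) (p b) (p (- (a + b))) (fun w => \prod_t trinom F d (w t))).
  move=> w; pose s (f : O -> 'I_d.+1) := (\sum_t (f (w t) : nat))%N.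
  have liftM f : (lift f w \in lowdeg d n) = (3 * s f <= d * n)%N.
    by rewrite inE; under eq_bigr do rewrite ffunE.
  have : (s (expo1 d) + s (expo2 d) + s (expo3 d) <= n * d)%N.
    rewrite /s -!big_split -[n in (n * d)%N]card_ord -sum_nat_const /=.
    by apply: leq_sum => t _; exact: expo_sum.
  by rewrite !liftM; lia.
move=> i j l; set x := enum_val i; set y := enum_val j; set z := enum_val l.
transitivity (\prod_t (1 - (a * x 0 t + b * y 0 t + - (a + b) * z 0 t) ^+ d)).
  under [RHS]eq_bigr do rewrite one_sub_trinomial.
  rewrite bigA_distr_bigA /=; apply: eq_bigr => w _.
  rewrite !big_split /p /=; congr (_ * (_ * _ * _)); apply: eq_bigr => t _;
    by rewrite ffunE.
have -> : (i == j) && (j == l) = (a *: x + b *: y == (a + b) *: z).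
  apply/andP/eqP => [[/eqP ij /eqP jl]|E].
    by rewrite /x /y /z ij jl scalerDl.
  have [] := capS x y z (enum_valP i) (enum_valP j) (enum_valP l) E.
  by move=> /enum_val_inj -> /enum_val_inj ->.
under eq_bigr do rewrite fin_eq0_indicator.
case: eqP => [E|nE].
  apply: big1 => t _; have := congr1 (fun u : 'rV_n => u 0 t) E.
  by rewrite !mxE => ->; rewrite mulNr subrr eqxx.
case: (pickP (fun t => a * x 0 t + b * y 0 t + - (a + b) * z 0 t != 0)) => [t ht|h0].
  by rewrite (bigD1 t) //= (negPf ht) mul0r.
case: nE; apply/rowP => t; rewrite !mxE; apply/eqP.
by have := h0 t; rewrite /= mulNr subr_eq0 => /negbFE.
Qed.

(** * Counting exponent vectors of low degree *)

Lemma one_sub_exp_bounds (R : realFieldType) (a : nat) (x : R) :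
  0 <= x <= 1 -> 1 - a%:R * x <= (1 - x) ^+ a <= 1 - a%:R * x + a%:R ^+ 2 * x ^+ 2.
Proof.
move=> /andP[x0 x1]; elim: a => [|a /andP[lo up]]; first by rewrite expr0 !mul0r; lra.
rewrite exprSr -natr1; have a0 : 0 <= a%:R :> R by [].
have y0 : 0 <= 1 - x by lra.
have ax : 0 <= a%:R * x by exact: mulr_ge0.
have xx : 0 <= x ^+ 2 by exact: sqr_ge0.
have axx : 0 <= a%:R * x ^+ 2 by exact: mulr_ge0.
have aaxxx : 0 <= a%:R ^+ 2 * x ^+ 2 * x by rewrite !mulr_ge0 ?exprn_ge0.
apply/andP; split.
  apply: le_trans (ler_wpM2r y0 lo); lra.
apply: le_trans (ler_wpM2r y0 up) _; lra.
Qed.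

(* At [u = 1] both sides are equal and the left one has the larger derivative,
   so the inequality holds slightly below [1]. *)
Lemma low_degree_weight (R : realFieldType) (d : nat) : (0 < d)%N ->
  exists u : R, 0 < u < 1 /\ \sum_(i < d.+1) u ^+ (3 * i) < d.+1%:R * u ^+ d.
Proof.
move=> d0; have d1 : 1 <= d%:R :> R by rewrite ler1n.
(* With [s = x * d] the final comparison reads [1 - 3/2 s + 9 s^2 < 1 - s], that is [s < 1/18]; here
   [s = 1/20]. *)
pose x : R := (20 * d%:R)^-1.
have x0 : 0 < x by rewrite invr_gt0; lra.
have xd : x * d%:R = 20^-1 by rewrite /x invfM mulfVK // gt_eqF //; lra.
have xxd : x * 1 <= x * d%:R by rewrite ler_pM2l.
have x1 : x < 1 by lra.
have bounds a := one_sub_exp_bounds R a x.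
exists (1 - x); split; first by lra.
have le_sum : \sum_(i < d.+1) (1 - x) ^+ (3 * i) <=
    \sum_(i < d.+1) (1 - 3 * x * i%:R + 9 * d%:R ^+ 2 * x ^+ 2).
  apply: ler_sum => i _; have /andP[_] := bounds (3 * i)%N ltac:(lra).
  move/le_trans; apply; rewrite natrM.
  have : i%:R ^+ 2 <= d%:R ^+ 2 :> R.
    by rewrite lerXn2r ?nnegrE // ler_nat -ltnS.
  move=> h; have := ler_wpM2r (sqr_ge0 x) h; lra.
have gauss : \sum_(i < d.+1) i%:R = d%:R * d.+1%:R / 2 :> R.
  elim: (d) => [|e IH]; first by rewrite big_ord1 /= !mul0r.
  by rewrite big_ord_recr /= IH -[e.+2%:R]natr1 -[e.+1%:R]natr1; field.
apply: le_lt_trans le_sum _.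
have /andP[lo _] := bounds d ltac:(lra).
apply: lt_le_trans (ler_wpM2l (ler0n _ _) lo).
rewrite !big_split /= sumrN -mulr_sumr gauss !sumr_const card_ord.
rewrite -[_ * _ *+ d.+1]mulr_natl.
have -> : d.+1%:R - 3 * x * (d%:R * d.+1%:R / 2) + d.+1%:R * (9 * d%:R ^+ 2 * x ^+ 2)
  = d.+1%:R * (1 - 3 / 2 * (x * d%:R) + 9 * (x * d%:R) ^+ 2) by field.
by rewrite ltr_pM2l // [d%:R * x]mulrC xd; lra.
Qed.

(** Exponential Markov bound: a vector of low degree has weight [u^(3 * degree)] at least
    [u^(d * n)], while the weights of all vectors add up to the [n]-th power of a sum over one
    coordinate. *)
Lemma lowdeg_exp_small (R : realFieldType) (d : nat) : (0 < d)%N ->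
  exists gamma : R, 0 < gamma < d.+1%:R /\
    forall n, #|lowdeg d n|%:R <= gamma ^+ n.
Proof.
case/(low_degree_weight R) => u [/andP[u0 u1] small].
have ud k : 0 < u ^+ k by exact: exprn_gt0.
exists ((\sum_(i < d.+1) u ^+ (3 * i)) / u ^+ d); split.
  rewrite ltr_pdivrMr // small andbT divr_gt0 //.
  by rewrite big_ord_recl ltr_wpDr ?sumr_ge0 // => i _; exact: ltW.
move=> n; rewrite expr_div_n -exprM ler_pdivlMr //.
have <- : \sum_(e : {ffun 'I_n -> 'I_d.+1}) u ^+ (3 * \sum_t (e t : nat))
  = (\sum_(i < d.+1) u ^+ (3 * i)) ^+ n.
  rewrite -[n in RHS]card_ord -prodr_const bigA_distr_bigA; apply: eq_bigr => e _.
  by rewrite big_distrr /= -expr_sum.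
rewrite [X in _ <= X](bigID (mem (lowdeg d n))) /=.
apply: ler_wpDr; first by apply: sumr_ge0 => e _; exact: ltW.
rewrite mulr_natl -sumr_const; apply: ler_sum => e; rewrite inE => le.
by apply: ler_wiXn2l => //; exact: ltW.
Qed.

Lemma cap_exp_small (R : realFieldType) (F : finFieldType) :
  exists gamma : R, 0 < gamma < #|F|%:R /\
  forall (n : nat) (a b : F) (S : {set 'rV[F]_n}),
  (forall x y z, x \in S -> y \in S -> z \in S ->
     a *: x + b *: y = (a + b) *: z -> x = y /\ y = z) ->
  #|S|%:R <= 3 * gamma ^+ n.
Proof.
have q1 := finNzRing_gt1 F.
have d0 : (0 < #|F|.-1)%N by rewrite -ltnS prednK // ltnW.
have [g [gq gn]] := lowdeg_exp_small R _ d0.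
exists g; split; first by rewrite prednK // in gq; rewrite ltnW.
move=> n a b S /cap_bound leS.
by rewrite (le_trans _ (ler_wpM2l _ (gn n))) // -natrM ler_nat.
Qed.

(** * Pairs with many replacements *)

Lemma card_bigcup_leq (I T : finType) (P : pred I) (A : I -> {set T}) :
  (#|\bigcup_(i | P i) A i| <= \sum_(i | P i) #|A i|)%N.
Proof.
elim/big_rec2: _ => [|i m B _ le]; first by rewrite cards0.
by rewrite cardsU; apply: leq_trans (leq_subr _ _) _; rewrite leq_add2l.
Qed.

(* A maximal independent set among the vertices of at most twice the average
   degree dominates these vertices, which are half of [S]. *)
Lemma sparse_independent_set (T : finType) (e : rel T) (S : {set T}) :
  exists I : {set T}, [/\ I \subset S,
    {in I &, forall x y, x != y -> ~~ e x y} &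
    (#|S| ^ 2 <= 2 * #|I| *
       (#|S| + 4 * #|[set p : T * T | [&& p.1 \in S, p.2 \in S & e p.1 p.2]]|))%N].
Proof.
set D := #|[set p : T * T | _]|; pose N x := [set y in S | e x y || e y x].
have sumN : (\sum_(x in S) #|N x| <= 2 * D)%N.
  have DE : D = (\sum_(x in S) \sum_(y in S) e x y)%N.
    rewrite /D -sum1_card pair_big_dep /= big_mkcond [RHS]big_mkcond /=.
    by apply: eq_bigr => -[x y] _; rewrite inE /=; do !case: (_ \in _); case: (e x y).
  rewrite mul2n -addnn {1}DE DE [X in (_ <= _ + X)%N]exchange_big -big_split /=.
  apply: leq_sum => x xS; rewrite -big_split /= -sum1_card big_mkcond [leqRHS]big_mkcond /=.
  by apply: leq_sum => y _; rewrite inE; case: (_ \in _) => //; case: (e x y); case: (e y x).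
pose T0 := [set x in S | #|N x| * #|S| <= 4 * D]%N.
have leT0 : (#|S| <= 2 * #|T0|)%N.
  have T0S : T0 \subset S by apply/subsetP => x; rewrite inE => /andP[].
  have := cardsID T0 S; rewrite (setIidPr T0S).
  suff : (#|S :\: T0| * 2 <= #|S|)%N by lia.
  (* Outside [T0] the product [#|N x| * #|S|] is at least [4 * D + 1]; this form also settles
     [D = 0]. *)
  have : (#|S :\: T0| * (4 * D + 1) <= 2 * D * #|S|)%N.
    rewrite -sum_nat_const; apply: leq_trans (_ : (\sum_(x in S) #|N x| * #|S| <= _)%N).
      rewrite [leqRHS](big_setID T0) /=; apply: leq_trans (leq_addl _ _).
      apply: leq_sum => x; rewrite !inE => /andP[+ xS]; rewrite xS /=; lia.
    by rewrite -big_distrl leq_mul2r sumN orbT.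
  nia.
pose indep (A : {set T}) := (A \subset T0) &&
  [forall x in A, forall y in A, (x != y) ==> ~~ e x y].
have indep0 : indep set0.
  by rewrite /indep sub0set /=; apply/forall_inP => x; rewrite inE.
have [I /maxsetP[/andP[IT0 /forall_inP Iind] Imax] _] := maxset_exists indep0.
have {}Iind : {in I &, forall x y, x != y -> ~~ e x y}.
  by move=> x y xI yI; move/(_ x xI)/forall_inP/(_ y yI)/implyP: Iind.
exists I; split => //.
  by apply: subset_trans IT0 _; apply/subsetP => x; rewrite inE => /andP[].
have cover : T0 \subset \bigcup_(x in I) (x |: N x).
  apply/subsetP => z zT0; apply/negPn/negP => nz.
  have zN x : x \in I -> [/\ x != z, ~~ e x z & ~~ e z x].
    move=> xI; have : z \notin x |: N x by apply: contra nz => h; apply/bigcupP; exists x.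
    rewrite !inE !negb_or negb_and.
    move: zT0; rewrite inE => /andP[-> _] /= /andP[zx]; rewrite negb_or => /andP[-> ->].
    by rewrite eq_sym.
  have nzI : z \notin I by apply/negP => /zN[]; rewrite eqxx.
  suff /Imax : indep (z |: I) by move/(_ (subsetUr _ _)) => EI; rewrite -EI setU11 in nzI.
  rewrite /indep subUset sub1set zT0 IT0 /=; apply/forall_inP => x xI.
  apply/forall_inP => y yI; apply/implyP; move: xI yI.
  move=> /setU1P[->|xI] /setU1P[->|yI]; rewrite ?eqxx // => nxy.
  - by have [] := zN _ yI.
  - by have [] := zN _ xI.
  - exact: Iind.
have {cover} := leq_trans (subset_leq_card cover) (card_bigcup_leq _ _ _ _).
move=> cover; have {cover} : (#|T0| <= \sum_(x in I) (1 + #|N x|))%N.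
  apply: leq_trans cover _; apply: leq_sum => x _; rewrite cardsU1; lia.
move/(leq_mul (leqnn #|S|)); rewrite big_distrr /=.
have : (\sum_(x in I) #|S| * (1 + #|N x|) <= \sum_(x in I) (#|S| + 4 * D))%N.
  apply: leq_sum => x xI; have := subsetP IT0 x xI; rewrite inE => /andP[_]; lia.
rewrite sum_nat_const; nia.
Qed.

Definition reps (F : finFieldType) (n : nat) (a b : F) (S : {set 'rV[F]_n})
    (w : 'rV[F]_n) : {set 'rV[F]_n * 'rV[F]_n} :=
  [set p | [&& p.1 \in S, p.2 \in S & a *: p.1 + b *: p.2 == w]].

(** The graph [e] joins [x] to [y] if a sum [a x + b y] with nonzero weights has few replacements,
    or if [(a + b) x] has few and [y] starts a relation [a y + b z = (a + b) x]. Independence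
    settles distinct points; the diagonal failures that remain form one cap for each [(a, b)] and
    are removed. *)
Lemma popular_pairs (R : realFieldType) (F : finFieldType) (K : nat) (beta1 gamma1 : R) :
  0 < beta1 -> 0 < gamma1 < #|F|%:R ->
  exists beta gamma : R, [/\ 0 < beta, 0 < gamma < #|F|%:R &
    forall (n : nat) (S : {set 'rV[F]_n}), beta * gamma ^+ n <= #|S|%:R ->
    exists S1 : {set 'rV[F]_n}, [/\ S1 \subset S, beta1 * gamma1 ^+ n <= #|S1|%:R &
      forall (a b : F) x y, a != 0 -> b != 0 -> x \in S1 -> y \in S1 ->
        (K <= #|reps F n a b S (a *: x + b *: y)|)%N]].
Proof.
move=> b1 /andP[g1 g1q].
have [g0 [/andP[g00 g0q] capP]] := cap_exp_small R F.
have q2 : 2 <= #|F|%:R :> R by rewrite ler_nat finNzRing_gt1.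
pose q : R := #|F|%:R.
pose g' := Num.max gamma1 (Num.max g0 1).
have g1g' : gamma1 <= g' by rewrite le_max lexx.
have g0g' : g0 <= g' by rewrite !le_max lexx orbT.
have g'1 : 1 <= g' by rewrite !le_max lexx !orbT.
have g'q : g' < q by rewrite !gt_max g1q g0q /=; apply: lt_le_trans q2; lra.
(* The number [D] of edges will be at most [2 K q^2 q^n], so [2 (|S| + 4 D) <= c q^n]. The term
   [3 q^2] of [b'] pays for the removal of [q^2] caps. *)
pose c := (2 + 16 * K * #|F| ^ 2)%N.
pose b' := beta1 + 3 * q ^+ 2.
have q0 : 0 <= q ^+ 2 by exact: sqr_ge0.
have b'0 : 0 < b' by rewrite /b'; lra.
have cb0 : 0 <= c%:R * b' by rewrite mulr_ge0 // ltW.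
(* The independent set has at least [|S|^2 / (c q^n)] points, and [((g' + q) / 2)^2 >= g' q] turns
   this into [b' g'^n]. The summand [K] ensures [K <= #|S|]. *)
exists (c%:R * b' + 1 + K%:R), ((g' + q) / 2); split.
- by apply: ltr_wpDr => //; lra.
- by apply/andP; split; [lra | move: g'q; rewrite /q; lra].
move=> n S; set b := _ + _ + _; set g := _ / 2 => leS.
have Q0 : 0 < q ^+ n by apply: exprn_gt0; move: q2; rewrite /q; lra.
have cardV : #|{: 'rV[F]_n}| = (#|F| ^ n)%N by rewrite card_mx mul1n.
have leSQ : (#|S| <= #|F| ^ n)%N by rewrite -cardV max_card.
have K0 : 0 <= K%:R :> R by [].
have b1' : 1 <= b by rewrite /b; lra.
have leKS : (K <= #|S|)%N.
  rewrite -(ler_nat R); apply: le_trans leS.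
  have : 1 <= g ^+ n by apply: exprn_ege1; rewrite /g; move: g'q; lra.
  by move=> h; apply: le_trans (ler_peMr _ h); rewrite /b; lra.
pose unpop a b w := [&& a != 0, b != 0 & (#|reps F n a b S w| < K)%N].
pose e x y := [exists a : F, exists b : F,
  unpop a b (a *: x + b *: y) || [&& a + b != 0, unpop a b ((a + b) *: x) &
     [exists z in S, a *: y + b *: z == (a + b) *: x]]].
have [I [IS Iind Ibig]] := sparse_independent_set _ e S.
(* [U] contains the edges charged to one triple [(a, b, w)]: at most [2 K] of them when [w] has few
   replacements. *)
pose U (i : F * F * 'rV[F]_n) := let: (a, b, w) := i in
  reps F n a b S w :|: [set ((a + b)^-1 *: w, p.1) | p in reps F n a b S w].
have leD : (#|[set p : 'rV[F]_n * 'rV[F]_n | [&& p.1 \in S, p.2 \in S & e p.1 p.2]]|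
   <= #|F| ^ 2 * #|F| ^ n * (2 * K))%N.
  apply: (@leq_trans (#|\bigcup_(i | unpop i.1.1 i.1.2 i.2) U i|)).
    apply/subset_leq_card/subsetP => -[x y]; rewrite inE /= => /and3P[xS yS].
    case/existsP => a /existsP[b0 /orP[up|/and3P[ab up /exists_inP[z zS /eqP E]]]].
      apply/bigcupP; exists (a, b0, a *: x + b0 *: y) => //.
      by rewrite !inE /= xS yS eqxx.
    apply/bigcupP; exists (a, b0, (a + b0) *: x) => //.
    apply/setUP; right; apply/imsetP; exists (y, z); rewrite ?inE /= ?yS ?zS ?E ?eqxx //.
    by rewrite scalerA mulVf // scale1r.
  apply: leq_trans (card_bigcup_leq _ _ _ _) _.
  have -> : (#|F| ^ 2 * #|F| ^ n = #|{: F * F * 'rV[F]_n}|)%N by rewrite !card_prod cardV mulnn.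
  rewrite -sum_nat_const big_mkcond /=; apply: leq_sum => -[[a b0] w] _ /=.
  case: ifP => // /and3P[_ _ lt]; apply: leq_trans (leq_of_leqif (leq_card_setU _ _)) _.
  by rewrite mul2n -addnn leq_add ?(leq_trans (leq_imset_card _ _)) // ltnW.
have {Ibig leD} Ibig : (#|S| ^ 2 <= #|I| * (c * #|F| ^ n))%N.
  apply: leq_trans Ibig _; rewrite /c; move: leD leSQ.
  set D := #|[set p : _ * _ | _]|; set X := #|S|.
  set Y := (#|F| ^ n)%N; set Z := (#|F| ^ 2)%N => leD leSQ.
  have -> : ((2 + 16 * K * Z) * Y = 2 * (Y + 4 * (Z * Y * (2 * K))))%N by ring.
  have : (2 * (X + 4 * D) <= 2 * (Y + 4 * (Z * Y * (2 * K))))%N.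
    by rewrite leq_mul2l leq_add // leq_mul2l.
  by move=> h; rewrite mulnC mulnA mulnC leq_mul2l mulnC h orbT.
have Ibig' : b' * g' ^+ n <= #|I|%:R.
  have cQ : 0 < c%:R * q ^+ n by rewrite mulr_gt0 // ltr0n /c; lia.
  rewrite -(ler_pM2r cQ); move: Ibig; rewrite -(ler_nat R) !natrM !natrX => /(le_trans _); apply.
  apply: le_trans (_ : (b * g ^+ n) ^+ 2 <= _); last first.
    rewrite lerXn2r // nnegrE // mulr_ge0 ?exprn_ge0 //; first by lra.
    by rewrite /g; move: g'q; lra.
  have -> : b' * g' ^+ n * (c%:R * q ^+ n) = c%:R * b' * (g' * q) ^+ n.
    by rewrite exprMn; ring.
  rewrite [(b * _) ^+ 2]exprMn exprAC; apply: ler_pM => //.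
  - by rewrite exprn_ge0 // mulr_ge0 //; move: g'q; lra.
  - apply: le_trans (_ : b <= _); first by rewrite /b; lra.
    by rewrite expr2 ler_peMr //; lra.
  - apply: lerXn2r; rewrite ?nnegrE ?sqr_ge0 // ?mulr_ge0 //; try (move: g'q; lra).
    by rewrite /g; have := sqr_ge0 (g' - q); nra.
(* [B a b0] is a cap: in a relation [a x + b0 y = (a + b0) z] inside it, [z] would be joined to [x]
   unless [x = z], and then [y = z]. *)
pose B a b0 := if a + b0 == 0 then set0 else [set x in I | unpop a b0 ((a + b0) *: x)].
have leB a b0 : (#|B a b0|)%:R <= 3 * g' ^+ n :> R.
  apply: le_trans (_ : 3 * g0 ^+ n <= _); last first.
    by rewrite ler_pM2l // lerXn2r ?nnegrE //; lra.
  apply: (capP n a b0) => x y z; rewrite /B; case: eqP => [_|/eqP ab]; rewrite inE // => + + +.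
  rewrite !inE => /andP[xI _] /andP[yI _] /andP[zI up] E.
  have [/and3P[a0 b00 _]] := up.
  have xz : x = z.
    apply/eqP/negPn/negP => nxz; have := Iind z x zI xI; rewrite eq_sym nxz => /(_ isT)/negP; apply.
    apply/existsP; exists a; apply/existsP; exists b0; rewrite ab up /=.
    by apply/orP; right; apply/exists_inP; exists y; [exact: (subsetP IS) | rewrite E].
  have yz : y = z by move: E; rewrite xz scalerDl => /addrI/(scalerI b00).
  by rewrite xz yz.
pose B' := \bigcup_(i : F * F) B i.1 i.2.
have leB' : #|B'|%:R <= q ^+ 2 * (3 * g' ^+ n).
  apply: le_trans (_ : (\sum_(i : F * F) #|B i.1 i.2|)%:R <= _).
    by rewrite ler_nat card_bigcup_leq.
  rewrite natr_sum; apply: le_trans (ler_sum _ (fun i _ => leB i.1 i.2)) _.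
  by rewrite sumr_const card_prod mulnn -[X in X <= _]mulr_natl natrX.
exists (I :\: B'); split.
- exact: subset_trans (subsetDl _ _) IS.
- have : (#|I|%:R : R) <= #|I :\: B'|%:R + #|B'|%:R.
    rewrite -natrD ler_nat -(cardsID B' I) addnC leq_add2l.
    exact/subset_leq_card/subsetIr.
  have : gamma1 ^+ n <= g' ^+ n by rewrite lerXn2r ?nnegrE //; lra.
  move=> /(ler_wpM2l (ltW b1)); move: Ibig' leB'; rewrite /b'; lra.
move=> a b0 x y a0 b00 /setDP[xI xB] /setDP[yI _]; rewrite leqNgt; apply/negP => lt.
have [E|nxy] := eqVneq x y; last first.
  have := Iind x y xI yI nxy => /negP; apply; apply/existsP; exists a; apply/existsP; exists b0.
  by rewrite /unpop a0 b00 lt.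
subst y; have [ab|ab] := eqVneq (a + b0) 0; last first.
  move/negP: xB; apply; apply/bigcupP; exists (a, b0) => //=.
  by rewrite /B (negPf ab) inE xI /unpop a0 b00 scalerDl lt.
(* When [a + b0 = 0] the sum is [0], and every pair [(u, u)] with [u] in [S] replaces it. *)
move: lt; apply/negP; rewrite -leqNgt -scalerDl ab scale0r.
apply: leq_trans leKS _.
have diag_inj : injective (fun u : 'rV[F]_n => (u, u)) by move=> u v [].
rewrite -(card_imset _ diag_inj); apply/subset_leq_card/subsetP => p /imsetP[u uS ->].
by rewrite inE /= uS -scalerDl ab scale0r eqxx.
Qed.

(** * Generic points with prescribed class sums *)

Section Exchange.

Variables (F : finFieldType) (k : nat) (rep : 'I_k -> 'I_k) (c : 'I_k -> F).
Hypothesis repK : forall j, rep (rep j) = rep j.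
Hypothesis c_neq0 : forall j, c j != 0.

(** The index runs over all of ['I_k] instead of the classes; at an index that is not a
    representative the sum is empty. *)
Definition class_sum n (x : 'I_k -> 'rV[F]_n) (i : 'I_k) : 'rV[F]_n :=
  \sum_(j | rep j == i) c j *: x j.

(** Induction on [r], making the non-representative points of index below [r] linearly independent
    modulo the span of the [y j]. The earlier points are found inside a popular subset [S2], so the
    pair at [j0] and [rep j0] has enough replacements in [S] to choose a new point at [j0]
    independent of the others. The change at [rep j0] is harmless, as independence concerns
    non-representatives only. *)
Lemma exchange_pairs (R : realFieldType) (r : nat) (beta1 gamma1 : R) :
  0 < beta1 -> 0 < gamma1 < #|F|%:R ->
  exists beta gamma : R, [/\ 0 < beta, 0 < gamma < #|F|%:R &
    forall (n : nat) (S : {set 'rV[F]_n}), beta * gamma ^+ n <= #|S|%:R ->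
    exists S1 : {set 'rV[F]_n}, [/\ S1 \subset S, beta1 * gamma1 ^+ n <= #|S1|%:R &
      forall x y : 'I_k -> 'rV[F]_n, (forall j, x j \in S1) ->
      exists x' : 'I_k -> 'rV[F]_n, [/\ forall j, x' j \in S,
        class_sum n x' =1 class_sum n x &
        forall b t : 'rV[F]_k, (forall j, b 0 j != 0 -> (j < r)%N && (rep j != j)) ->
          \sum_j b 0 j *: x' j = \sum_j t 0 j *: y j -> b = 0]]].
Proof.
elim: r beta1 gamma1 => [|r IH] beta1 gamma1 b1 g1.
  exists beta1, gamma1; split => // n S leS; exists S; split => // x y xS.
  exists x; split => // b t supp _; apply/rowP => j; rewrite mxE; apply/eqP.
  by apply/negPn/negP => /supp.
have [beta' [gamma' [b' g' {}IH]]] := IH _ _ b1 g1.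
have [j0 /andP[/eqP j0r j0rep]|no_j] :=
  pickP (fun j : 'I_k => (val j == r) && (rep j != j)); last first.
  exists beta', gamma'; split => // n S /IH[S1 [sub leS1 H]]; exists S1; split => // x y xS.
  have [x' [x'S x'x ind]] := H x y xS; exists x'; split => // b t supp; apply: ind => j bj.
  have /andP[lt nrep] := supp j bj; rewrite nrep andbT ltn_neqAle -ltnS lt andbT.
  by have := no_j j; rewrite nrep andbT => ->.
(* One more than the number of pairs of coefficient vectors, hence more than the size of [bad]
   below. *)
pose K := #|{: 'rV[F]_k * 'rV[F]_k}|.+1.
have [beta [gamma [b2 g2 pop]]] := popular_pairs R F K _ _ b' g'.
exists beta, gamma; split => // n S /pop[S2 [S2S leS2 {}pop]].
have [S1 [S1S2 leS1 {}IH]] := IH n S2 leS2.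
exists S1; split => //; first exact: subset_trans S2S.
move=> x y xS1; have [x' [x'S2 x'x ind]] := IH x y xS1.
pose w := c j0 *: x' j0 + c (rep j0) *: x' (rep j0).
pose bad := [set \sum_j bt.2 0 j *: y j + \sum_j bt.1 0 j *: x' j
  | bt : 'rV[F]_k * 'rV[F]_k].
have [p pR pbad] : exists2 p, p \in reps F n (c j0) (c (rep j0)) S w & p.1 \notin bad.
  have lt : (#|bad| < #|reps F n (c j0) (c (rep j0)) S w|)%N.
    apply: leq_trans (pop _ _ _ _ (c_neq0 _) (c_neq0 _) (x'S2 _) (x'S2 _)).
    by rewrite ltnS; exact: leq_imset_card.
  have fst_inj : {in reps F n (c j0) (c (rep j0)) S w &, injective fst}.
    move=> [u v] [u' v']; rewrite !inE /= => /and3P[_ _ /eqP <-] /and3P[_ _ /eqP E] uu'.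
    by move: E; rewrite uu' => /addrI/(scalerI (c_neq0 _)) ->.
  have [/subsetP sub|] := boolP (fst @: reps F n (c j0) (c (rep j0)) S w \subset bad).
    have := subset_leq_card (introT subsetP sub).
    by rewrite (card_in_imset fst_inj) leqNgt lt.
  by case/subsetPn => u /imsetP[p pR ->] ?; exists p.
move: pR; rewrite inE => /and3P[p1S p2S /eqP pw].
pose x2 j := if j == j0 then p.1 else if j == rep j0 then p.2 else x' j.
have x2E j : rep j != j -> j != j0 -> x2 j = x' j.
  move=> nrep nj0; rewrite /x2 (negPf nj0); case: eqP => // E.
  by rewrite E repK eqxx in nrep.
exists x2; split.
- move=> j; rewrite /x2; case: ifP => // _; case: ifP => // _.
  exact: (subsetP S2S).
- move=> i; rewrite -x'x /class_sum; have [<-|ni] := eqVneq (rep j0) i.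
    rewrite !(bigD1 j0 (P := fun j => rep j == _)) //=.
    rewrite !(bigD1 (rep j0) (P := fun j => (rep j == _) && _)) /=; last 2 first.
    + by rewrite repK eqxx.
    + by rewrite repK eqxx.
    rewrite !addrA; congr (_ + _).
      by rewrite /x2 eqxx (negPf j0rep) eqxx pw.
    by apply: eq_bigr => j /andP[/andP[_ /negPf n1] /negPf n2]; rewrite /x2 n1 n2.
  apply: eq_bigr => j /eqP ji; rewrite /x2; case: eqP => [E|_].
    by rewrite -ji E eqxx in ni.
  by case: eqP => // E; rewrite -ji E repK eqxx in ni.
move=> b t supp E.
have suppr j : b 0 j != 0 -> rep j != j by move/supp/andP => [].
have x2sum : \sum_(j | j != j0) b 0 j *: x2 j = \sum_(j | j != j0) b 0 j *: x' j.
  apply: eq_bigr => j nj; have [->|bj] := eqVneq (b 0 j) 0; first by rewrite !scale0r.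
  by rewrite x2E ?suppr.
move: E; rewrite (bigD1 j0) //= x2sum {1}/x2 eqxx => E.
have [bj0|bj0] := eqVneq (b 0 j0) 0.
  apply: (ind b t); last by rewrite -E [LHS](bigD1 j0) //= bj0 !scale0r.
  move=> j bj; have /andP[lt ->] := supp j bj; rewrite andbT ltn_neqAle -ltnS lt andbT.
  by apply: contraNneq bj => jr; rewrite (_ : j = j0) ?bj0 //; apply/val_inj; rewrite /= jr.
case/imsetP: pbad.
(* Dividing the relation by [b 0 j0] would express [p.1] as an element of [bad]. *)
exists (\row_j (if j == j0 then 0 else - (b 0 j / b 0 j0)), (b 0 j0)^-1 *: t) => //=.
apply: (scalerI bj0); rewrite scalerDr !scaler_sumr.
rewrite [X in _ = _ + X](bigD1 j0) //= mxE eqxx scale0r scaler0 add0r.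
have -> : b 0 j0 *: p.1 = \sum_j t 0 j *: y j - \sum_(j | j != j0) b 0 j *: x' j.
  by rewrite -E addrK.
rewrite -sumrN; congr (_ + _); apply: eq_bigr => j.
  by move=> _; rewrite mxE scalerA mulrA mulfV // mul1r.
by move=> /negPf nj; rewrite mxE nj scaleNr scalerN scalerA mulrCA mulfV // mulr1.
Qed.

End Exchange.

(** Pigeonhole on the map sending a tuple [z] to the vectors [lambda i0 z_i - lambda i z_i0] for
    [i != i0]: it has one component fewer than [z], and two tuples with the same image have
    differences proportional to [lambda]. *)
Lemma scaled_differences (R : realFieldType) (F : finFieldType) (k : nat)
    (lambda : 'I_k -> F) (i0 : 'I_k) : lambda i0 != 0 ->
  exists beta gamma : R, [/\ 0 < beta, 0 < gamma < #|F|%:R &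
    forall (n : nat) (S : {set 'rV[F]_n}), beta * gamma ^+ n <= #|S|%:R ->
    exists (z z' : 'I_k -> 'rV[F]_n) (y : 'rV[F]_n),
      [/\ forall i, z i \in S, forall i, z' i \in S, y != 0 &
          forall i, z i - z' i = lambda i *: y]].
Proof.
case: k lambda i0 => [lambda []//|k] lambda i0 l0.
pose q : R := #|F|%:R.
have q2 : 2 <= q by rewrite ler_nat finNzRing_gt1.
have k1 : 1 <= k.+1%:R :> R by rewrite ler1n.
have qi : 0 < q^-1 <= 2^-1.
  by rewrite invr_gt0 lef_pV2 ?posrE //; lra.
(* Bernoulli's inequality gives [(1 - x)^(k+1) >= 1 - (k+1) x = 1/q], so [gamma = q (1 - x)]
   satisfies [gamma^(k+1) >= q^k]; [beta = 2] makes the pigeonhole inequality strict. *)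
pose x := (1 - q^-1) / k.+1%:R.
have xk : k.+1%:R * x = 1 - q^-1 by rewrite mulrC divfK // gt_eqF //; lra.
have x0 : 0 < x by rewrite divr_gt0 //; lra.
have x1 : x < 1 by have := ler_wpM2r (ltW x0) k1; lra.
have /andP[lo _] := one_sub_exp_bounds R k.+1 x ltac:(lra).
have g0 : 0 < q * (1 - x) by rewrite mulr_gt0; lra.
exists 2, (q * (1 - x)); split; [lra | rewrite g0 /= gtr_pMr; lra |].
move=> n S leS.
have big : (#|'rV[F]_n| ^ k < #|S| ^ k.+1)%N.
  rewrite card_mx mul1n -(ltr_nat R) !natrX -/q.
  apply: (@lt_le_trans _ _ ((2 * (q * (1 - x)) ^+ n) ^+ k.+1)); last first.
    by rewrite lerXn2r // nnegrE // mulr_ge0 // exprn_ge0 // ltW.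
  have Q0 : 0 < (q ^+ k) ^+ n by rewrite !exprn_gt0 //; lra.
  rewrite [X in _ < X]exprMn [_ ^+ n ^+ k]exprAC [_ ^+ n ^+ k.+1]exprAC.
  have : (q ^+ k) ^+ n <= ((q * (1 - x)) ^+ k.+1) ^+ n.
    have q_ge0 : 0 <= q by lra.
    rewrite lerXn2r ?nnegrE ?exprn_ge0 ?(ltW g0) //.
    have -> : q ^+ k = q ^+ k.+1 * q^-1 by rewrite exprSr mulfK // gt_eqF //; lra.
    by rewrite [X in _ <= X]exprMn ler_wpM2l ?exprn_ge0 //; move: lo; rewrite xk; lra.
  have : 2 <= 2 ^+ k.+1 :> R by rewrite exprS ler_peMr // exprn_ege1 //; lra.
  by move=> h1 h2; have := ler_pM (ltW (ltr0Sn _ 1)) (ltW Q0) h1 h2; lra.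
pose X : {set {ffun 'I_k.+1 -> 'rV[F]_n}} := [set z in ffun_on (mem S)].
pose f (z : {ffun 'I_k.+1 -> 'rV[F]_n}) : {ffun 'I_k -> 'rV[F]_n} :=
  [ffun j => lambda i0 *: z (lift i0 j) - lambda (lift i0 j) *: z i0].
have [/dinjectiveP f_inj|] := boolP (dinjectiveb f X).
  have := max_card (mem (f @: X)); rewrite card_in_imset // cardsE card_ffun_on card_ord.
  by rewrite card_ffun card_ord leqNgt big.
case/dinjectivePn => z; rewrite inE => /ffun_onP zS [z'].
rewrite !inE => /andP[nzz' /ffun_onP z'S] E.
have diff i : lambda i0 *: (z i - z' i) = lambda i *: (z i0 - z' i0).
  case: (unliftP i0 i) => [j ->|-> //].
  have := congr1 (fun g : {ffun 'I_k -> 'rV_n} => g j) E; rewrite !ffunE => {}E.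
  rewrite !scalerBr; apply/eqP; rewrite -subr_eq0; move/eqP: E; rewrite -subr_eq0.
  by congr (_ == _); rewrite !opprB addrACA [RHS]addrACA; congr (_ + _); rewrite addrC.
exists z, z', ((lambda i0)^-1 *: (z i0 - z' i0)); split => //; last first.
  move=> i; apply: (scalerI l0); rewrite diff !scalerA; congr (_ *: _).
  by rewrite mulrAC mulfV // mul1r.
apply: contraNneq nzz' => y0; apply/eqP/ffunP => i; apply/eqP.
rewrite eq_sym -subr_eq0; apply/eqP/(scalerI l0); rewrite diff scaler0.
by have := congr1 (fun u => lambda i *: (lambda i0 *: u)) y0; rewrite scalerKV // !scaler0.
Qed.

(** * Column classes and the initial solution *)

Lemma colequivP (F : finFieldType) (m k : nat) (M : 'M[F]_(m, k)) (j j' : 'I_k) :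
  reflect (exists2 c : F, c != 0 & forall i, M i j = c * M i j') (colequiv M j j').
Proof.
apply: (iffP existsP) => [[c /andP[c0 /eqP E]]|[c c0 E]]; exists c => //.
  by move=> i; have := congr1 (fun u : 'cV_m => u i 0) E; rewrite !mxE.
by rewrite c0; apply/eqP/colP => i; rewrite !mxE.
Qed.

Lemma class_representatives (F : finFieldType) (m k : nat) (A : 'M[F]_(m, k)) :
  exists (rep : 'I_k -> 'I_k) (c : 'I_k -> F),
    [/\ forall j, c j != 0, forall j, rep j = j -> c j = 1,
        forall i j, A i j = c j * A i (rep j) &
        forall j j', colequiv A j j' = (rep j == rep j')].
Proof.
have refl j : colequiv A j j.
  by apply/colequivP; exists 1; rewrite ?oner_eq0 // => i; rewrite mul1r.
have sym j j' : colequiv A j j' -> colequiv A j' j.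
  case/colequivP => c c0 E; apply/colequivP; exists c^-1; rewrite ?invr_eq0 // => i.
  by rewrite E mulrA mulVf // mul1r.
have trans j1 j2 j3 : colequiv A j1 j2 -> colequiv A j2 j3 -> colequiv A j1 j3.
  case/colequivP => c c0 E /colequivP[d d0 E']; apply/colequivP.
  by exists (c * d); rewrite ?mulf_neq0 // => i; rewrite E E' mulrA.
(* The result of [pick] depends only on the predicate, so equivalent columns get the same
   representative. *)
pose rep j := odflt j [pick i | colequiv A j i].
have repP j : colequiv A j (rep j).
  by rewrite /rep; case: pickP => [i|] //= /(_ j); rewrite refl.
have repE j j' : colequiv A j j' = (rep j == rep j').
  apply/idP/eqP => [jj'|E].
    rewrite /rep (eq_pick (Q := fun i => colequiv A j' i)) => [|i].
      by case: pickP => [i|/(_ j')] //=; rewrite refl.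
    by apply/idP/idP; apply: trans => //; exact: sym.
  by apply: trans (repP j) _; rewrite E; exact/sym/repP.
have /fin_all_exists[c cP] j : exists cj : F,
    [/\ cj != 0, rep j = j -> cj = 1 & forall i, A i j = cj * A i (rep j)].
  have [E|nE] := eqVneq (rep j) j.
    by exists 1; split; rewrite ?oner_eq0 // => i; rewrite mul1r E.
  have /colequivP[d d0 E] := repP j; exists d; split => //.
  by move=> E'; rewrite E' eqxx in nE.
by exists rep, c; split => //; [move=> j | move=> j | move=> i j]; case: (cP j).
Qed.

Section Representatives.

Variables (F : finFieldType) (m k : nat) (A : 'M[F]_(m, k)).
Variables (rep : 'I_k -> 'I_k) (c : 'I_k -> F).
Hypothesis c_neq0 : forall j, c j != 0.
Hypothesis c_rep : forall j, rep j = j -> c j = 1.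
Hypothesis A_rep : forall i j, A i j = c j * A i (rep j).
Hypothesis colequiv_rep : forall j j', colequiv A j j' = (rep j == rep j').

Lemma rep_idem j : rep (rep j) = rep j.
Proof.
apply/eqP; rewrite -colequiv_rep; apply/colequivP; exists (c j)^-1; rewrite ?invr_eq0 // => i.
by rewrite (A_rep i j) mulrA mulVf // mul1r.
Qed.

Lemma nclasses_rep : (#|[set j | rep j != j]| + nclasses A)%N = k.
Proof.
have -> : nclasses A = #|[set j | rep j == j]|.
  rewrite /nclasses.
  have classE j j' : (colclass A j == colclass A j') = (rep j == rep j').
    apply/eqP/eqP => [E|E]; last by apply/setP => i; rewrite !inE !colequiv_rep E.
    have : j' \in colclass A j by rewrite E inE colequiv_rep.
    by rewrite inE colequiv_rep => /eqP.
  have -> : [set colclass A j | j : 'I_k] = [set colclass A j | j in [set j | rep j == j]].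
    apply/setP => C; apply/imsetP/imsetP => -[j _ ->]; last by exists j.
    exists (rep j); first by rewrite inE rep_idem.
    by apply/eqP; rewrite classE rep_idem.
  rewrite card_in_imset // => j j'; rewrite !inE => /eqP jj /eqP jj' /eqP.
  by rewrite classE jj jj' => /eqP.
have := cardsC [set j | rep j == j]; rewrite card_ord addnC => cardk; apply: etrans cardk.
by congr (_ + _)%N; apply: eq_card => j; rewrite !inE.
Qed.

Lemma is_solution_class_sum n (x : 'I_k -> 'rV[F]_n) :
  is_solution A x <-> forall i, \sum_j A i j *: class_sum F k rep c n x j = 0.
Proof.
have E i : \sum_j A i j *: x j = \sum_j A i j *: class_sum F k rep c n x j.
  rewrite (partition_big rep predT) //=; apply: eq_bigr => j' _.
  rewrite scaler_sumr; apply: eq_bigr => j /eqP jj'.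
  by rewrite A_rep jj' scalerA mulrC.
by split => H i; have := H i; rewrite E.
Qed.

(** Appending a row can only split classes, and none splits here because the new row has the same
    ratios [c j / c j'] as the columns of [A]. *)
Lemma preserves_classes_rep (b : 'rV[F]_k) :
  (forall j, b 0 j = b 0 (rep j) * c j) -> preserves_classes A b.
Proof.
move=> bE j j'; apply/idP/idP => [/colequivP[d d0 E]|].
  apply/colequivP; exists d => // i.
  by have := E (lshift 1 i); rewrite !col_mxEu.
rewrite colequiv_rep => /eqP jj'; apply/colequivP.
exists (c j / c j'); first by rewrite mulf_neq0 ?invr_eq0.
move=> i; rewrite !mxE; case: split => i'.
  by rewrite A_rep [in RHS]A_rep jj' mulrA divfK.
by rewrite ord1 (bE j) (bE j') jj' mulrCA divfK // mulrC.
Qed.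

(** Subtracting the class sums with coefficients [b 0 (rep j)] leaves a relation with coefficients
    [b 0 j - b 0 (rep j) * c j]. These vanish at representatives, so the independence hypothesis
    makes them all zero. *)
Lemma satisfied_equation_rep n (x : 'I_k -> 'rV[F]_n) :
  (forall b t : 'rV[F]_k, (forall j, b 0 j != 0 -> rep j != j) ->
     \sum_j b 0 j *: x j = \sum_j t 0 j *: class_sum F k rep c n x j -> b = 0) ->
  forall b : 'rV[F]_k, \sum_j b 0 j *: x j = 0 -> forall j, b 0 j = b 0 (rep j) * c j.
Proof.
move=> ind b bx j; apply/eqP; rewrite -subr_eq0; apply/eqP.
have /(congr1 (fun u : 'rV_k => u 0 j)) : \row_j (b 0 j - b 0 (rep j) * c j) = 0.
  apply: (ind _ (- b)) => [j'|].
    by rewrite mxE; apply: contraNneq => E; rewrite E (c_rep _ E) mulr1 subrr.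
  under eq_bigr do rewrite mxE scalerBl.
  rewrite sumrB bx sub0r -sumrN (partition_big rep predT) //=.
  apply: eq_bigr => i _; rewrite mxE scaleNr /class_sum scaler_sumr -sumrN.
  by apply: eq_bigr => j' /eqP <-; rewrite scalerA.
by rewrite !mxE.
Qed.

(** Row [i] of [B] holds the weights [c] of class [i]. Without a dependency [B] would have the row
    space of [A], and since each of its rows meets only one class, the system would be reducible. *)
Lemma irreducible_dependent (j1 j2 : 'I_k) :
  sys_irreducible A -> rep j1 != rep j2 ->
  exists (lambda : 'I_k -> F) (i0 : 'I_k),
    [/\ lambda i0 != 0, forall i, lambda i != 0 -> rep i = i &
        forall i, \sum_j A i j * lambda j = 0].
Proof.
move=> irr n12.
pose P (l : 'cV[F]_k) := [&& A *m l == 0, l != 0 & [forall i, (l i 0 != 0) ==> (rep i == i)]].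
have [l /and3P[/eqP Al l0 /forallP supp]|noP] := pickP P.
  have [i0 li0|l_0] := pickP (fun i => l i 0 != 0); last first.
    by case/eqP: l0; apply/colP => i; rewrite mxE; apply/eqP/negPn; rewrite l_0.
  exists (fun i => l i 0), i0; split => // [i|i]; first by move/(implyP (supp i))/eqP.
  by have := congr1 (fun u : 'cV_m => u i 0) Al; rewrite !mxE.
case: irr; pose B : 'M[F]_k := \matrix_(i, j) ((rep j == i)%:R * c j).
have AB : A *m B = A.
  apply/matrixP => i j; rewrite mxE (bigD1 (rep j)) //= big1 => [|i' ni'].
    by rewrite mxE eqxx mul1r addr0 mulrC -A_rep.
  by rewrite mxE eq_sym (negPf ni') mul0r mulr0.
exists k, B, (fun j => rep j : nat); split; last split.
- apply/andP; split; last by rewrite -{1}AB submxMl.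
  rewrite submxE; apply/eqP/matrixP => i s.
  have := noP (col s (B *m cokermx A)); apply: contraFeq; rewrite [X in _ != X]mxE => nz.
  apply/and3P; split; first by rewrite colE mulmxA [A *m _]mulmxA AB mulmx_coker mul0mx.
    apply: contraNneq nz => E; have := congr1 (fun u : 'cV_k => u i 0) E.
    by rewrite mxE => ->; rewrite mxE.
  apply/forallP => i'; apply/implyP; apply: contraNT => ni'.
  rewrite mxE [X in X == _]mxE big1 // => j _; rewrite mxE; case: eqP => [E|_].
    by rewrite -E rep_idem eqxx in ni'.
  by rewrite !mul0r.
- by exists j1, j2.
- have rowB i j : B i j != 0 -> rep j = i.
    by rewrite mxE; apply: contraTeq => /negPf ->; rewrite mul0r eqxx.
  by move=> i j j' /rowB-> /rowB->.
Qed.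

End Representatives.

(** * Affine dimension of a generic solution *)

Lemma affdim_ge (F : finFieldType) (k n : nat) (x : 'I_k -> 'rV[F]_n)
    (J : {set 'I_k}) (i0 : 'I_k) :
  (forall b : 'I_k -> F, (forall j, b j != 0 -> (j \in J) || (j == i0)) ->
     \sum_j b j = 0 -> \sum_j b j *: x j = 0 -> forall j, j \in J -> b j = 0) ->
  i0 \notin J -> #|J|%:Z <= affdim x.
Proof.
move=> ind i0J; rewrite /affdim; have -> : (k == 0%N) = false.
  by apply/negbTE; rewrite -lt0n; apply: leq_ltn_trans (ltn_ord i0).
rewrite lez_nat; pose X := [tuple x (enum_val s) - x i0 | s < #|J|].
have freeX : free X.
  apply/freeP => u; under eq_bigr => s _ do rewrite -tnth_nth tnth_mktuple.
  move=> ux s.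
  (* [v] extends [u] by zero from [J] to all indices, and [b] subtracts the total at [i0] so that
     its entries sum to zero. *)
  pose v j := \sum_(s | enum_val s == j) u s.
  pose b j := v j - (j == i0)%:R * \sum_s u s.
  have vJ j : j \notin J -> v j = 0.
    by move=> nj; rewrite /v big_pred0 // => s'; apply: contraNF nj => /eqP <-; exact: enum_valP.
  have bJ j : j \in J -> b j = v j.
    move=> jJ; rewrite /b (_ : (j == i0) = false) ?mul0r ?subr0 //.
    by apply: contraNF i0J => /eqP <-.
  have v_enum : v (enum_val s) = u s.
    by rewrite /v (big_pred1 s) // => s'; rewrite (inj_eq enum_val_inj).
  rewrite -v_enum -bJ ?enum_valP //; apply: ind (enum_valP s).
  - move=> j; case: (boolP (j \in J)) => //= nj; apply: contraR => /negPf ni.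
    by rewrite /b vJ // ni mul0r subr0.
  - rewrite sumrB (bigD1 i0 (F := fun j => _ * _)) //= eqxx mul1r.
    rewrite [X in _ - (_ + X)]big1 ?addr0 => [|j /negPf ->]; last by rewrite mul0r.
    by rewrite [X in _ - X](partition_big enum_val predT) //= subrr.
  under eq_bigr do rewrite scalerBl; rewrite sumrB.
  rewrite (bigD1 i0 (F := fun j => (_ * _) *: _)) //= eqxx mul1r.
  rewrite [X in _ - (_ + X)]big1 ?addr0 => [|j /negPf ->]; last by rewrite mul0r scale0r.
  rewrite -[RHS]ux; under [RHS]eq_bigr do rewrite scalerBr.
  rewrite sumrB -scaler_suml; congr (_ - _).
  rewrite [RHS](partition_big enum_val predT) //=; apply: eq_bigr => j _.
  by rewrite /v scaler_suml; apply: eq_bigr => s' /eqP ->.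
move: freeX; rewrite /free size_tuple => /eqP <-; apply/dimvS/span_subvP => w.
case/tnthP => s ->; rewrite tnth_mktuple; apply/memv_span/allpairsP.
by exists (enum_val s, i0); rewrite !mem_enum.
Qed.

(** An affine relation on the non-representatives and [i0] has coefficient zero at every other
    representative, so it is a multiple of [c] on the class of [i0]; either of the first two
    alternatives forces the multiple to be zero. With a single class, a further index [j1] is left
    out, and its zero coefficient forces all the others to vanish. *)
Lemma affdim_class_bound (F : finFieldType) (m k n : nat) (A : 'M[F]_(m, k))
    (rep : 'I_k -> 'I_k) (c : 'I_k -> F) (x : 'I_k -> 'rV[F]_n) (i0 : 'I_k) :
  (#|[set j | rep j != j]| + nclasses A)%N = k ->
  (forall j, c j != 0) -> (forall j, rep (rep j) = rep j) -> rep i0 = i0 ->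
  (forall b : 'rV[F]_k, \sum_j b 0 j *: x j = 0 -> forall j, b 0 j = b 0 (rep j) * c j) ->
  [\/ \sum_(j | rep j == i0) c j != 0, class_sum F k rep c n x i0 != 0 |
      forall j, rep j = i0] ->
  Num.min (k%:Z - (nclasses A)%:Z) (k%:Z - 2) <= affdim x.
Proof.
move=> cardk c0 repK ri0 bE.
have bfE (b : 'I_k -> F) : \sum_j b j *: x j = 0 -> forall j, b j = b (rep j) * c j.
  move=> bx j; have := bE (\row_j b j) _ j; rewrite !mxE; apply.
  by rewrite -[RHS]bx; apply: eq_bigr => j' _; rewrite mxE.
have nonrep : (\sum_(j | rep j == i0) c j != 0) || (class_sum F k rep c n x i0 != 0) ->
    #|[set j | rep j != j]|%:Z <= affdim x.
  move=> nz; apply: (affdim_ge _ _ _ _ _ i0); last by rewrite inE ri0 eqxx.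
  move=> b supp sumb bx; have b_rep := bfE b bx.
  have b_other j : rep j != i0 -> b (rep j) = 0.
    move=> nj; apply/eqP/negPn/negP => /supp.
    by rewrite inE repK eqxx (negPf nj).
  have b_class j : b j = if rep j == i0 then b i0 * c j else 0.
    by case: eqP => [E|/eqP nj]; rewrite b_rep ?E // b_other // mul0r.
  suff bi0 : b i0 = 0 by move=> j _; rewrite b_class bi0 mul0r if_same.
  case/orP: nz => nz.
    move: sumb; under eq_bigr do rewrite b_class.
    rewrite -big_mkcond -mulr_sumr => /eqP; rewrite mulf_eq0 (negPf nz) orbF.
    by move/eqP.
  have : b i0 *: class_sum F k rep c n x i0 = 0.
    rewrite -[RHS]bx /class_sum scaler_sumr big_mkcond; apply: eq_bigr => j _.
    by rewrite [b j]b_class; case: ifP; rewrite ?scalerA ?scale0r.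
  by move/eqP; rewrite scaler_eq0 (negPf nz) orbF => /eqP.
have kE : k%:Z - (nclasses A)%:Z = #|[set j | rep j != j]|%:Z.
  by rewrite -[in k%:Z]cardk PoszD addrK.
case=> [nz|nz|all_i0]; rewrite ge_min kE.
- by rewrite nonrep ?nz.
- by rewrite nonrep ?nz ?orbT.
apply/orP; right.
have [j1 nj1|no_j] := pickP (fun j => j != i0).
  have -> : k%:Z - 2 = #|~: [set i0; j1]|%:Z.
    have := cardsC [set i0; j1]; rewrite cards2 eq_sym nj1 card_ord => kE'.
    by rewrite -[in k%:Z]kE' PoszD addrC addKr.
  apply: (affdim_ge _ _ _ _ _ i0); last by rewrite !inE eqxx.
  move=> b supp _ bx j _; have b_rep := bfE b bx; rewrite b_rep all_i0.
  suff -> : b i0 = 0 by rewrite mul0r.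
  have : b j1 = 0.
    by apply/eqP/negPn/negP => /supp; rewrite !inE (negPf nj1) eqxx orbT.
  by rewrite b_rep all_i0 => /eqP; rewrite mulf_eq0 (negPf (c0 _)) orbF => /eqP.
have k1 : k = 1%N.
  rewrite -[LHS]card_ord -(cards1 i0) -cardsT; apply: eq_card => j.
  by rewrite !inE; have := no_j j; case: eqP.
apply: (@le_trans _ _ 0); first by rewrite subr_le0 lez_nat k1.
by rewrite /affdim; case: ifP => // /eqP k0; move: k1; rewrite {1}k0.
Qed.

Lemma nondegenerate_class_sums (R : realFieldType) (F : finFieldType) (m k : nat)
    (A : 'M[F]_(m, k)) (rep : 'I_k -> 'I_k) (c : 'I_k -> F) :
  (0 < k)%N -> (forall j, c j != 0) -> (forall j, rep j = j -> c j = 1) ->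
  (forall i j, A i j = c j * A i (rep j)) ->
  (forall j j', colequiv A j j' = (rep j == rep j')) ->
  balanced_sys A -> sys_irreducible A ->
  exists beta gamma : R, [/\ 0 < beta, 0 < gamma < #|F|%:R &
    forall (n : nat) (S : {set 'rV[F]_n}), beta * gamma ^+ n <= #|S|%:R ->
    exists x : 'I_k -> 'rV[F]_n, [/\ forall j, x j \in S, is_solution A x &
      exists2 i0, rep i0 = i0 & [\/ \sum_(j | rep j == i0) c j != 0,
        class_sum F k rep c n x i0 != 0 | forall j, rep j = i0]]].
Proof.
move=> k0 c0 c_rep A_rep colE bal irr.
have repK := rep_idem _ _ _ _ _ _ c0 A_rep colE.
have constant i0 : rep i0 = i0 ->
    \sum_(j | rep j == i0) c j != 0 \/ (forall j, rep j = i0) ->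
    exists beta gamma : R, [/\ 0 < beta, 0 < gamma < #|F|%:R &
      forall (n : nat) (S : {set 'rV[F]_n}), beta * gamma ^+ n <= #|S|%:R ->
      exists x : 'I_k -> 'rV[F]_n, [/\ forall j, x j \in S, is_solution A x &
        exists2 i0, rep i0 = i0 & [\/ \sum_(j | rep j == i0) c j != 0,
          class_sum F k rep c n x i0 != 0 | forall j, rep j = i0]]].
  (* Balance makes every constant tuple a solution, so [S] only has to be nonempty. *)
  move=> ri0 good; exists 1, 1; split; rewrite ?ltr01 ?ltr1n ?finNzRing_gt1 // => n S.
  rewrite mul1r expr1n ler1n card_gt0 => /set0Pn[s sS]; exists (fun=> s); split => //.
    by move=> i; rewrite -scaler_suml bal scale0r.
  by exists i0 => //; case: good => ?; [apply: Or31 | apply: Or33].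
have [i0 /andP[/eqP ri0 nz]|sums0] :=
    pickP (fun i => (rep i == i) && (\sum_(j | rep j == i) c j != 0)).
  by apply: (constant i0) => //; left.
pose i1 := rep (Ordinal k0).
have [j1 nj1|all_i1] := pickP (fun j => rep j != i1); last first.
  by apply: (constant i1); [exact: repK | right => j; have /negbFE/eqP := all_i1 j].
have [lambda [i0 [l0 l_rep Al]]] :=
  irreducible_dependent _ _ _ _ _ _ c0 A_rep colE _ _ irr nj1.
have [beta [gamma [b0 g0 diff]]] := scaled_differences R F k lambda i0 l0.
exists beta, gamma; split => // n S /diff[z [z' [y [zS z'S y0 zz']]]].
(* In each class the coefficients sum to zero and the representative has coefficient [1], so the
   others sum to [-1] and the class sum is [z i - z' i]. *)
pose x j := if rep j == j then z j else z' (rep j).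
have sums i : class_sum F k rep c n x i = lambda i *: y.
  have [ri|nri] := eqVneq (rep i) i; last first.
    rewrite /class_sum big_pred0 => [|j]; last first.
      by apply: contraNF nri => /eqP <-; rewrite repK.
    suff -> : lambda i = 0 by rewrite scale0r.
    by apply/eqP; apply: contraNT nri => /l_rep ->.
  have := sums0 i; rewrite ri eqxx /= => /negbFE/eqP; rewrite (bigD1 i) ?ri //= c_rep //.
  move=> /eqP; rewrite addrC addr_eq0 => /eqP rest.
  rewrite /class_sum (bigD1 i) ?ri //= c_rep // scale1r {1}/x ri eqxx -zz'; congr (_ + _).
  rewrite -[RHS]scaleN1r -rest scaler_suml; apply: eq_bigr => j /andP[/eqP rj nji].
  by rewrite /x rj eq_sym (negPf nji).
exists x; split.
- by move=> j; rewrite /x; case: ifP.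
- apply/(is_solution_class_sum _ _ _ _ _ _ A_rep) => i.
  under eq_bigr do rewrite sums scalerA.
  by rewrite -scaler_suml Al scale0r.
- exists i0; first exact: l_rep.
  by apply: Or32; rewrite sums scaler_eq0 negb_or l0.
Qed.

Theorem theoremC (R : realType) (F : finFieldType) (m k : nat) (A : 'M[F]_(m, k)) :
  sys_typeRC A -> sys_nondegenerate A -> sys_irreducible A ->
  exists beta gamma : R, 0 < beta /\ 0 < gamma /\ gamma < (#|F|%:R : R) /\
    forall (n : nat) (S : {set 'rV[F]_n}),
      beta * gamma ^+ n <= (#|S|%:R : R) ->
      exists x : 'I_k -> 'rV[F]_n,
        (forall j, x j \in S) /\ is_solution A x /\
        (forall b : 'rV[F]_k,
            \sum_(j < k) b 0 j = 0 -> \sum_(j < k) b 0 j *: x j = 0 ->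
            preserves_classes A b) /\
        Num.min (k%:Z - (nclasses A)%:Z) (k%:Z - 2) <= affdim x.
Proof.
move=> [bal _] _ irr; case: (posnP k) => [k0|k_gt0].
  subst k; exists 1, 1; do !split; rewrite ?ltr01 ?ltr1n ?finNzRing_gt1 // => n S _.
  exists (fun=> 0); split; [by case | split; last split].
  - by move=> i; rewrite big_ord0.
  - by move=> b _ _ [].
  - by rewrite /affdim eqxx ge_min orbC.
have [rep [c [c0 c_rep A_rep colE]]] := class_representatives _ _ _ A.
have repK := rep_idem _ _ _ _ _ _ c0 A_rep colE.
have [beta1 [gamma1 [b1 g1 init]]] :=
  nondegenerate_class_sums R _ _ _ _ _ _ k_gt0 c0 c_rep A_rep colE bal irr.
have [beta [gamma [b0 /andP[g0 gq] exch]]] :=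
  exchange_pairs _ _ _ _ repK c0 R k _ _ b1 g1.
exists beta, gamma; do 3!split => //; move=> n S /exch[S1 [_ /init[x0 [x0S1 sol good]] {}exch]].
(* The family [y] is taken to be the class sums, which the exchange preserves; with [r = k] all
   non-representative points become independent modulo them. *)
have [x [xS sums ind]] := exch x0 (class_sum F k rep c n x0) x0S1.
have b_rep : forall b : 'rV[F]_k, \sum_j b 0 j *: x j = 0 -> forall j, b 0 j = b 0 (rep j) * c j.
  apply: satisfied_equation_rep => // b t supp E; apply: (ind b t) => [j /supp ->|].
    by rewrite ltn_ord.
  by rewrite E; apply: eq_bigr => j _; rewrite sums.
exists x; split => //; split; last split.
- apply/(is_solution_class_sum _ _ _ _ _ _ A_rep) => i.
  under eq_bigr do rewrite sums.
  exact: (iffLR (is_solution_class_sum _ _ _ _ _ _ A_rep _ _) sol).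
- by move=> b _ /b_rep; apply: preserves_classes_rep A_rep colE b.
- have [i0 ri0 good0] := good; apply: (affdim_class_bound _ _ _ _ _ rep c _ i0) => //.
    exact: (nclasses_rep _ _ _ _ _ _ c0 A_rep colE).
  by rewrite sums.
Qed.
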